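(* Let $p$ be a prime and $q$ a power of $p$. Let $N\geq 5$, $q>3$, and let $\Gamma$ be a subgroup of $\mathrm{GU}_N(q)$ such that (1) $\Gamma$ is absolutely irreducible; (2) $\Gamma$ contains $\mathrm{SU}_a(q)$ for some $a\geq N/2$. If $N\neq 2a$, then $\Gamma$ contains $\mathrm{SU}_N(q)$. Otherwise (if $N=2a$), either $\Gamma$ contains $\mathrm{SU}_N(q)$, or $\Gamma$ is, up to conjugacy in $\mathrm{GU}_N(q)$, a subgroup of $\mathrm{GU}_{N/2}(q)\wr\mathfrak{S}_2$.
   Context: $\mathrm{GU}_N(q)\subset\mathrm{GL}_N(\mathbb{F}_{q^2})$ is the group of matrices preserving the standard nondegenerate Hermitian form on $\mathbb{F}_{q^2}^N$ (with respect to $x\mapsto x^q$), and $\mathrm{SU}_N(q)=\mathrm{GU}_N(q)\cap\mathrm{SL}_N(\mathbb{F}_{q^2})$. For $a\le N$, $\mathrm{SU}_a(q)$ is viewed inside $\mathrm{GU}_N(q)$ via the standard block embedding: it acts naturally on a nondegenerate $a$-dimensional subspace (spanned by $a$ vectors of the standard orthonormal basis) and trivially on its orthogonal complement. $\mathrm{GU}_{N/2}(q)\wr\mathfrak{S}_2$ denotes the stabilizer in $\mathrm{GU}_N(q)$ of an (unordered) orthogonal decomposition $\mathbb{F}_{q^2}^N=W_1\perp W_2$ with $\dim W_1=\dim W_2=N/2$. Absolute irreducibility refers to the action on $\mathbb{F}_{q^2}^N$. $\mathfrak{S}_2$ is the symmetric group on two letters. *)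

(* Defs.v *)
From HB Require Import structures.
From mathcomp Require Import all_boot all_order all_fingroup all_algebra.
From mathcomp Require Import all_solvable all_field all_character.

Set Implicit Arguments.
Unset Strict Implicit.
Unset Printing Implicit Defensive.

Import GRing.Theory.
Local Open Scope ring_scope.

(* Vectors are rows and matrices act on the right, as in mxrepresentation.
   Throughout, F is meant to have q ^ 2 elements. *)

Section Unitary.

Variables (F : finFieldType) (q : nat).

Definition herm n (u v : 'rV[F]_n) : F := \sum_(i < n) u 0 i * v 0 i ^+ q.

Definition GUmx n : {set 'M[F]_n} :=
  [set A | [forall u : 'rV[F]_n, forall v : 'rV[F]_n,
              herm (u *m A) (v *m A) == herm u v]].

Definition SUmx n : {set 'M[F]_n} := [set A in GUmx n | \det A == 1].

(* Since {'GL_n[F]} consists of matrices of size n.-1.+1, which is only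
   propositionally equal to n (for n > 0), GU and SU are sets of invertible
   matrices of that size. *)
Definition GU n : {set {'GL_n[F]}} := [set g | GLval g \in GUmx n.-1.+1].

Definition SU n : {set {'GL_n[F]}} := [set g | GLval g \in SUmx n.-1.+1].

(* The block matrix diag(A, I) of size n; when a > n the dimensions do not
   match and the value is the identity matrix. *)
Definition block_embed n a (A : 'M[F]_a) : 'M[F]_n :=
  conform_mx 1%:M (block_mx A 0 0 (1%:M : 'M[F]_(n - a))).

Definition SU_in n a : {set {'GL_n[F]}} :=
  [set g | GLval g \in [set block_embed n.-1.+1 A | A in SUmx a]].

(* The stabilizer in GU of the unordered pair of row spaces {W1, W2}. *)
Definition GU_stab_pair n (W1 W2 : 'M[F]_n.-1.+1) : {set {'GL_n[F]}} :=
  [set g in GU n |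
     ((W1 *m GLval g == W1)%MS && (W2 *m GLval g == W2)%MS)
  || ((W1 *m GLval g == W2)%MS && (W2 *m GLval g == W1)%MS)].

(* GU_(n/2)(q) wr S_2 for even n: the decomposition is into the span of the
   first n/2 standard basis vectors (the row space of pid_mx n./2) and the span
   of the last n/2 ones (the row space of copid_mx n./2). *)
Definition GU_wr2 n : {set {'GL_n[F]}} :=
  GU_stab_pair (pid_mx n./2) (copid_mx n./2).

End Unitary.

Section NaturalRepresentation.

Variables (F : finFieldType) (n : nat) (G : {group {'GL_n[F]}}).

Lemma GL_mx_repr : mx_repr G (fun g : {'GL_n[F]} => GLval g).
Proof. by []. Qed.

Definition GL_repr : mx_representation F G n.-1.+1 := MxRepresentation GL_mx_repr.

End NaturalRepresentation.

(* Main.v *)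
Require Import Defs.
From HB Require Import structures.
From mathcomp Require Import all_boot all_order all_fingroup all_algebra.
From mathcomp Require Import all_solvable all_field all_character.
From mathcomp Require Import ring zify.

(** Write h for the Hermitian form, and for a nondegenerate subspace U (one with
    V = U + U^perp) write SU(U) for the isometries of determinant 1 that are the
    identity on U^perp. The hypothesis gives SU(U) <= Gamma for the span U of
    the first a basis vectors, of dimension a >= N/2 and a >= 3.

    Call an isotropic vector x a root vector if all its transvections
    y |-> y + l h(y, x) x, where l^q = -l, lie in Gamma. Root vectors are
    permuted by Gamma and include the isotropic vectors of U. Two cases arise.

    Suppose that some root vector lies neither in U nor in U^perp. By
    irreducibility the root vectors span V, and a computation on hyperbolic
    lines yields a root vector u + w with u in U and w in U^perp not isotropic
    (root_nonisotropic_part). Since SU(U) is transitive on the nonzero vectors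
    of U of given norm (SUon_trans, the part of Witt's theorem that the proof
    uses), every isotropic vector of U + <w> is a root vector (root_add). These
    transvections and SU(U) act transitively on the vectors of U + <w> with the
    norm of w (norm_trans); as the stabilizer of w in SU(U + <w>) is SU(U), it
    follows that SU(U + <w>) <= Gamma (SUon_add). So U can be enlarged.

    Suppose that all root vectors lie in U or U^perp. For g in Gamma, the images
    of isotropic vectors of U are root vectors, and any two of them that are not
    orthogonal lie on the same side; hence Ug is contained in U or in U^perp
    (image_dichotomy). If dim U > N/2 the second possibility is excluded by
    dimension, so U is invariant and U = V by irreducibility. If dim U = N/2
    then Gamma permutes {U, U^perp}.

    Thus SU(V) <= Gamma as soon as dim U > N/2, by induction on the codimension
    (SU_large); and if a = N/2, then either one enlargement leads to that
    situation or Gamma preserves the standard decomposition itself, so that the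
    conjugating element can be taken to be 1 (SU_or_imprimitive). *)

Set Implicit Arguments.
Unset Strict Implicit.
Unset Printing Implicit Defensive.

Import GRing.Theory.
Local Open Scope ring_scope.

(** * The quadratic extension *)

Section UnitaryGeometry.

Variables (p q : nat) (F : finFieldType).
Hypotheses (p_prime : prime p) (q_pow : exists k : nat, q = (p ^ k)%N).
Hypothesis cardF : #|F| = (q ^ 2)%N.

Lemma q_gt1 : (1 < q)%N.
Proof.
have := finNzRing_gt1 F; rewrite cardF; case: (q) => [|[|r]] //.
Qed.

Lemma conjD (x y : F) : (x + y) ^+ q = x ^+ q + y ^+ q.
Proof.
have [k qE] := q_pow; apply: exprDn_pchar.
have cF : #|F| = (p ^ (k * 2))%N by rewrite cardF qE expnM.
have pF := card_finPcharP cF p_prime.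
rewrite (eq_pnat _ (pcharf_eq pF)) qE pnatX /= pnat_id //.
Qed.

Lemma conjK (x : F) : (x ^+ q) ^+ q = x.
Proof. by rewrite -exprM mulnn -cardF expf_card. Qed.

Lemma conj0 : 0 ^+ q = 0 :> F.
Proof. by rewrite expr0n; case: q q_gt1. Qed.

Lemma conjN (x : F) : (- x) ^+ q = - x ^+ q.
Proof. by apply/eqP; rewrite -addr_eq0 -conjD addNr conj0. Qed.

Lemma conj_sum I (r : seq I) (P : pred I) (f : I -> F) :
  (\sum_(i <- r | P i) f i) ^+ q = \sum_(i <- r | P i) f i ^+ q.
Proof. exact: (big_morph (fun x : F => x ^+ q) conjD conj0). Qed.

Lemma conj_eq0 (x : F) : (x ^+ q == 0) = (x == 0).
Proof. by rewrite expf_eq0 (ltnW q_gt1). Qed.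

Lemma nonroot_small (P : {poly F}) :
  P != 0 -> (size P <= q.+1)%N -> exists x, P.[x] != 0.
Proof.
move=> P0 sP; apply/existsP; apply: contraT.
rewrite negb_exists => /forallP all0.
have := max_poly_roots P0 (_ : all (root P) (enum F)) (enum_uniq F).
rewrite -cardE cardF => /(_ _) lt; have {lt}lt : (q ^ 2 < size P)%N.
  by apply: lt; apply/allP=> x _; rewrite rootE; have:= all0 x; rewrite negbK.
have := leq_trans lt sP.
rewrite ltnS leqNgt -[X in (X < _)%N]expn1 ltn_exp2l //; exact: q_gt1.
Qed.

Lemma exists_trace_neq0 : exists x : F, x + x ^+ q != 0.
Proof.
have sP : size ('X^q + 'X : {poly F}) = q.+1.
  by rewrite size_polyDl ?size_polyXn ?size_polyX // ltnS q_gt1.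
have [||x] := @nonroot_small ('X^q + 'X); first by rewrite -size_poly_gt0 sP.
  by rewrite sP.
by rewrite !hornerE addrC; exists x.
Qed.

Lemma exists_not_fixed : exists x : F, x ^+ q != x.
Proof.
have sP : size ('X^q - 'X : {poly F}) = q.+1.
  by rewrite size_polyDl ?size_polyXn ?size_polyN ?size_polyX // ltnS q_gt1.
have [||x] := @nonroot_small ('X^q - 'X); first by rewrite -size_poly_gt0 sP.
  by rewrite sP.
by rewrite !hornerE subr_eq0; exists x.
Qed.

Lemma trace_onto (m : F) : m ^+ q = m -> exists t, t + t ^+ q = m.
Proof.
move=> mq; have [x x0] := exists_trace_neq0.
have fx : (x + x ^+ q) ^+ q = x + x ^+ q by rewrite conjD conjK addrC.
exists (m / (x + x ^+ q) * x); rewrite !exprMn exprVn mq fx.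
by rewrite -mulrDr divfK.
Qed.

Lemma exists_skew : exists2 l : F, l != 0 & l ^+ q = - l.
Proof.
have [x x0] := exists_not_fixed; exists (x ^+ q - x); first by rewrite subr_eq0.
by rewrite conjD conjN conjK opprB addrC.
Qed.

Lemma exists_norm1 : exists2 z : F, z != 1 & z * z ^+ q = 1.
Proof.
have [x xq] := exists_not_fixed.
have x0 : x != 0 by apply: contraNneq xq => ->; rewrite conj0.
have xq0 : x ^+ q != 0 by rewrite conj_eq0.
exists (x ^+ q / x); last by rewrite exprMn exprVn conjK; field; apply/andP.
by apply: contraNneq xq => /(congr1 ( *%R^~ x)); rewrite divfK // mul1r => ->.
Qed.

(** The fixed field is cyclic of order q - 1 up to zero, inside a cyclic group
    of order (q - 1)(q + 1): its elements are the (q + 1)-st powers. *)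
Lemma norm_onto (m : F) : m ^+ q = m -> exists t, t * t ^+ q = m.
Proof.
move=> mq; have [->|m0] := eqVneq m 0; first by exists 0; rewrite mul0r.
have F_gt1 := finNzRing_gt1 F; set n := #|F|.-1.
have n_gt0 : (0 < n)%N by rewrite -ltnS prednK // ltnW.
have unitn (x : F) : x != 0 -> x ^+ n = 1.
  move=> x0; apply: (mulfI x0).
  by rewrite -exprS prednK ?expf_card ?mulr1 // ltnW.
have /(has_prim_root n_gt0)/=  : all n.-unity_root (enum (predC1 (0 : F))).
  by apply/allP=> x; rewrite mem_enum unity_rootE => /unitn->.
rewrite enum_uniq -cardE cardC1 leqnn => /(_ isT isT)/hasP[w _ prw].
have [[i _] /= mE] := prim_rootP prw (unitn m m0).
have mq1 : m ^+ q.-1 = 1.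
  by apply: (mulfI m0); rewrite -exprS prednK ?mulr1 // ltnW ?q_gt1.
have q1 : (0 < q.-1)%N by rewrite -ltnS prednK ?q_gt1 // ltnW ?q_gt1.
have nE : n = (q.+1 * q.-1)%N.
  by rewrite /n cardF -subn1 (subn_sqr q 1) subn1 addn1 mulnC.
move/eqP: mq1; rewrite mE -exprM -(prim_order_dvd prw) nE dvdn_pmul2r //.
case/dvdnP=> j ->; exists (w ^+ j); by rewrite -exprS exprM.
Qed.


(** * The Hermitian form and orthogonal complements *)

Notation "''[' u , v ]" := (herm q u v)
  (at level 0, format "''[' u ,  v ]") : ring_scope.

Section Form.

Variable n : nat.
Implicit Types (x y u v w d r : 'rV[F]_n) (U W : 'M[F]_n).

Lemma herm0l v : '[0, v] = 0.
Proof. by rewrite /herm big1 // => i _; rewrite mxE mul0r. Qed.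

Lemma hermDl u v w : '[u + v, w] = '[u, w] + '[v, w].
Proof.
by rewrite /herm -big_split /=; apply: eq_bigr => i _; rewrite mxE mulrDl.
Qed.

Lemma hermZl a u v : '[a *: u, v] = a * '[u, v].
Proof.
by rewrite /herm mulr_sumr; apply: eq_bigr => i _; rewrite mxE mulrA.
Qed.

Lemma hermC u v : '[v, u] = '[u, v] ^+ q.
Proof.
rewrite /herm conj_sum; apply: eq_bigr => i _.
by rewrite exprMn conjK mulrC.
Qed.

Lemma herm0r v : '[v, 0] = 0.
Proof. by rewrite hermC herm0l conj0. Qed.

Lemma hermDr u v w : '[u, v + w] = '[u, v] + '[u, w].
Proof. by rewrite hermC hermDl conjD -!hermC. Qed.

Lemma hermZr a u v : '[u, a *: v] = a ^+ q * '[u, v].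
Proof. by rewrite hermC hermZl exprMn -hermC. Qed.

Lemma hermNl u v : '[- u, v] = - '[u, v].
Proof. by rewrite -scaleN1r hermZl mulN1r. Qed.

Lemma hermNr u v : '[u, - v] = - '[u, v].
Proof. by rewrite hermC hermNl conjN -hermC. Qed.

Definition hermE := (hermNl, hermNr, hermDl, hermDr, hermZl, hermZr).

Lemma norm_sub u v : '[u - v, u - v] = '[u, u] - '[u, v] - '[v, u] + '[v, v].
Proof. by rewrite !hermE; ring. Qed.

Lemma norm_conj u : '[u, u] ^+ q = '[u, u].
Proof. by rewrite -hermC. Qed.

Lemma herm_eq0C u v : ('[u, v] == 0) = ('[v, u] == 0).
Proof. by rewrite (hermC u v) conj_eq0. Qed.

Lemma herm_sumr (I : finType) u (f : I -> 'rV_n) :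
  '[u, \sum_i f i] = \sum_i '[u, f i].
Proof.
exact: (big_morph (fun v => '[u, v]) (fun x y => hermDr u x y) (herm0r u)).
Qed.

Lemma herm_mx u v : u *m (map_mx (fun x : F => x ^+ q) v)^T = ('[u, v])%:M.
Proof.
apply/matrixP=> i j; rewrite !mxE !ord1 eqxx; apply: eq_bigr => k _.
by rewrite !mxE.
Qed.

Lemma herm_nondeg u : (forall v, '[u, v] = 0) -> u = 0.
Proof.
move=> u0; apply/rowP=> i; rewrite mxE -(u0 (delta_mx 0 i)) /herm (bigD1 i) //=.
rewrite !mxE !eqxx expr1n mulr1 big1 ?addr0 // => j ji.
by rewrite mxE (negPf ji) andbF conj0 mulr0.
Qed.

Definition perp m (A : 'M[F]_(m, n)) : 'M[F]_n :=
  kermx (map_mx (fun x : F => x ^+ q) A)^T.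

Lemma perpP m (A : 'M[F]_(m, n)) x :
  reflect (forall y, (y <= A)%MS -> '[x, y] = 0) (x <= perp A)%MS.
Proof.
have rowE i : (x *m (map_mx (fun z : F => z ^+ q) A)^T) 0 i = '[x, row i A].
  by rewrite !mxE; apply: eq_bigr => k _; rewrite !mxE.
apply: (iffP sub_kermxP) => [xA y /submxP[z ->] | xA].
  rewrite mulmx_sum_row herm_sumr big1 // => i _.
  by rewrite hermZr -rowE xA mxE mulr0.
by apply/rowP=> i; rewrite rowE xA ?row_sub // mxE.
Qed.

Lemma perp_rVP x y : reflect ('[x, y] = 0) (x <= perp y)%MS.
Proof.
apply: (iffP (perpP y x)) => [-> // | xy z /sub_rVP[a ->]].
by rewrite hermZr xy mulr0.
Qed.

Lemma perpC m (A : 'M[F]_(m, n)) x y :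
  (x <= perp A)%MS -> (y <= A)%MS -> '[y, x] = 0.
Proof. by move=> /perpP xA /xA xy; rewrite hermC xy conj0. Qed.

Lemma subrV m1 m2 (A : 'M[F]_(m1, n)) (B : 'M_(m2, n)) :
  (forall x, (x <= A)%MS -> (x <= B)%MS) -> (A <= B)%MS.
Proof. by move=> sAB; apply/row_subP=> i; apply/sAB/row_sub. Qed.

(** For a nondegenerate ambient form this is equivalent to U meeting perp U
    trivially; the spanning form directly provides orthogonal decompositions. *)
Definition nondeg U := row_full (U + perp U)%MS.

Lemma nondegP U :
  reflect (forall x, exists2 u, (u <= U)%MS & (x - u <= perp U)%MS) (nondeg U).
Proof.
apply: (iffP idP) => [ndU x | ndU].
  have /sub_addsmxP[[a b] /= ->] : (x <= U + perp U)%MS by apply: submx_full.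
  by exists (a *m U); rewrite ?submxMl // addrC addKr submxMl.
rewrite /nondeg -sub1mx; apply: subrV => x _; have [u uU xu] := ndU x.
by rewrite -(subrK u x) addrC addmx_sub_adds.
Qed.

Lemma nondeg_decomp U x : nondeg U ->
  exists u w, [/\ (u <= U)%MS, (w <= perp U)%MS & x = u + w].
Proof.
move=> /nondegP/(_ x)[u uU xu]; exists u, (x - u).
by split; rewrite // addrC subrK.
Qed.

Lemma nondeg_eq0 U x : nondeg U -> (x <= U)%MS -> (x <= perp U)%MS -> x = 0.
Proof.
move=> ndU xU xP; apply: herm_nondeg => v.
have [u [w [uU wP ->]]] := nondeg_decomp v ndU.
by rewrite hermDr (perpP _ _ xP) // (perpC wP) // addr0.
Qed.

Lemma nondeg_rank U : nondeg U -> (\rank U + \rank (perp U))%N = n.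
Proof.
move=> ndU; rewrite -mxrank_disjoint_sum; first exact/eqP.
apply/eqP; rewrite -submx0; apply: subrV => x.
rewrite sub_capmx => /andP[xU xP].
by rewrite (nondeg_eq0 ndU xU xP) sub0mx.
Qed.

Lemma nondeg_ex U x : nondeg U -> (x <= U)%MS -> x != 0 ->
  exists2 y, (y <= U)%MS & '[y, x] != 0.
Proof.
move=> ndU xU x0.
have /existsP[y /andP[]] : [exists y : 'rV_n, (y <= U)%MS && ('[y, x] != 0)].
  apply: contraNT x0; rewrite negb_exists => /forallP all0.
  apply/eqP/(nondeg_eq0 ndU xU)/perpP=> y yU; have := all0 y.
  by rewrite yU negbK -herm_eq0C => /eqP.
by exists y.
Qed.

(** By polarization: c^q <x, y> has nonzero trace for some c as soon as
    <x, y> is nonzero. *)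
Lemma nondeg_nonisotropic U : nondeg U -> (0 < \rank U)%N ->
  exists2 r, (r <= U)%MS & '[r, r] != 0.
Proof.
rewrite lt0n mxrank_eq0 => ndU U0; set x := nz_row U.
have xU : (x <= U)%MS := nz_row_sub U.
have [|y yU xy] := nondeg_ex ndU xU; first by rewrite nz_row_eq0.
have [xx|] := eqVneq '[x, x] 0; last by exists x.
have [yy|] := eqVneq '[y, y] 0; last by exists y.
have [z z0] := exists_trace_neq0.
exists (z / '[y, x] *: y + x); first by rewrite addmx_sub ?scalemx_sub.
rewrite !hermE xx yy (hermC y x) !(mulr0, add0r, addr0) exprMn exprVn.
by rewrite !divfK ?conj_eq0.
Qed.

Lemma nondeg_cap U r : nondeg U -> (r <= U)%MS -> '[r, r] != 0 ->
  nondeg (U :&: perp r)%MS /\ (\rank U <= (\rank (U :&: perp r)%MS).+1)%N.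
Proof.
move=> ndU rU r0.
have split u : (u <= U)%MS -> (u - ('[u, r] / '[r, r]) *: r <= U :&: perp r)%MS.
  move=> uU; rewrite sub_capmx addmx_sub ?eqmx_opp ?scalemx_sub //=.
  by apply/perp_rVP; rewrite !hermE divfK // subrr.
split.
  apply/nondegP=> x; have [u [w [uU wP ->]]] := nondeg_decomp x ndU.
  exists (u - ('[u, r] / '[r, r]) *: r); first exact: split.
  apply/perpP=> y; rewrite sub_capmx => /andP[yU /perp_rVP yr].
  have -> a : u + w - (u - a) = w + a by rewrite opprB addrC addrA subrK addrC.
  by rewrite !hermE (hermC y r) yr conj0 (perpP _ _ wP) // mulr0 addr0.
have: (U <= U :&: perp r + r)%MS.
  apply: subrV => u /split su; rewrite -(subrK (('[u, r] / '[r, r]) *: r) u).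
  by rewrite addmx_sub_adds ?scalemx_sub.
move/mxrankS/leq_trans; apply; apply: leq_trans (mxrank_adds_leqif _ _) _.
by rewrite -[X in (_ <= X)%N]addn1 leq_add2l rank_leq_row.
Qed.

Lemma nondeg_add U w : nondeg U -> (w <= perp U)%MS -> '[w, w] != 0 ->
  nondeg (U + w)%MS /\ (\rank U < \rank (U + w)%MS)%N.
Proof.
move=> ndU wP w0; split.
  apply/nondegP=> x; have [u [v [uU vP ->]]] := nondeg_decomp x ndU.
  exists (u + ('[v, w] / '[w, w]) *: w).
    by rewrite addmx_sub_adds ?scalemx_sub.
  apply/perpP=> _ /sub_addsmxP[[a b] /= ->].
  have -> c : u + v - (u + c) = v - c by rewrite opprD addrACA subrr add0r.
  rewrite [b]mx11_scalar mul_scalar_mx hermDr hermZr !(hermDl, hermNl, hermZl).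
  rewrite (perpP _ _ vP (a *m U)) ?(perpP _ _ wP (a *m U)) ?submxMl //.
  by rewrite divfK // subrr !(mulr0, addr0, oppr0).
rewrite ltn_neqAle mxrankS ?addsmxSl // andbT; apply: contraNneq w0 => eqr.
have wU : (w <= U)%MS.
  apply: submx_trans (addsmxSr U w) _.
  by rewrite -(geq_leqif (mxrank_leqif_sup (addsmxSl U w))) eqr.
by rewrite (nondeg_eq0 ndU wU wP) herm0l.
Qed.

(** * Isometries and quasi-reflections *)

Implicit Types M : 'M[F]_n.

Lemma GUmxP M :
  reflect (forall u v, '[u *m M, v *m M] = '[u, v]) (M \in GUmx F q n).
Proof.
rewrite inE; apply: (iffP forallP) => [uM u v | uM u].
  by apply/eqP; have /forallP := uM u.
by apply/forallP=> v; apply/eqP.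
Qed.

Lemma GUmx1 : 1%:M \in GUmx F q n.
Proof. by apply/GUmxP=> u v; rewrite !mulmx1. Qed.

Lemma GUmx_mul M M' : M \in GUmx F q n -> M' \in GUmx F q n ->
  M *m M' \in GUmx F q n.
Proof.
by move=> /GUmxP uM /GUmxP uM'; apply/GUmxP=> u v; rewrite !mulmxA uM' uM.
Qed.

Lemma GUmx_unit M : M \in GUmx F q n -> M \in unitmx.
Proof.
move/GUmxP=> uM; rewrite -row_free_unit; apply: inj_row_free => u uM0.
by apply: herm_nondeg => v; rewrite -uM uM0 herm0l.
Qed.

Lemma GUmx_inv M : M \in GUmx F q n -> invmx M \in GUmx F q n.
Proof.
move=> uM; have /GUmxP hM := uM; apply/GUmxP=> u v.
by rewrite -[LHS]hM !mulmxKV ?GUmx_unit.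
Qed.

Lemma GUmx_perp m (A : 'M_(m, n)) M x : M \in GUmx F q n ->
  (x <= perp A)%MS -> (x *m M <= perp (A *m M))%MS.
Proof.
move=> /GUmxP uM /perpP xA; apply/perpP=> _ /submxP[z ->].
by rewrite mulmxA uM xA ?submxMl.
Qed.

Lemma det_conj M : \det (map_mx (fun x : F => x ^+ q) M) = \det M ^+ q.
Proof.
rewrite /determinant conj_sum; apply: eq_bigr => s _.
rewrite exprMn; congr (_ * _).
  by case: (odd_perm s); rewrite ?conjN !expr1n.
by rewrite -prodrXl; apply: eq_bigr => i _; rewrite mxE.
Qed.

Lemma GUmx_det M : M \in GUmx F q n -> \det M * \det M ^+ q = 1.
Proof.
move/GUmxP=> uM; rewrite -det_conj -[X in _ * X]det_tr -det_mulmx -(det1 F n).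
congr (\det _); apply/matrixP=> i j.
transitivity '[row i M, row j M].
  by rewrite mxE; apply: eq_bigr => k _; rewrite !mxE.
rewrite !rowE uM /herm (bigD1 i) //= big1 ?addr0 => [|k ki].
  rewrite !mxE !eqxx mul1r /= [RHS]mulrb.
  by case: eqP => _; rewrite ?expr1n ?conj0.
by rewrite mxE (negPf ki) andbF mul0r.
Qed.

(** The map x |-> x + c <x, d> d: a transvection if d is isotropic, and
    otherwise a quasi-reflection with axis the complement of d. *)
Definition refl d (c : F) : 'M[F]_n :=
  1%:M + c *: ((map_mx (fun x : F => x ^+ q) d)^T *m d).

Lemma mul_refl x d c : x *m refl d c = x + (c * '[x, d]) *: d.
Proof.
by rewrite mulmxDr mulmx1 -scalemxAr mulmxA herm_mx mul_scalar_mx scalerA.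
Qed.

Lemma refl_GU d c : c + c ^+ q + c * c ^+ q * '[d, d] = 0 ->
  refl d c \in GUmx F q n.
Proof.
move=> cP; apply/GUmxP=> u v; rewrite !mul_refl !hermE exprMn -(hermC v).
transitivity ('[u, v]
  + '[u, d] * '[d, v] * (c + c ^+ q + c * c ^+ q * '[d, d])); first by ring.
by rewrite cP mulr0 addr0.
Qed.

(** This is det (1 + a b) = 1 + b a for a column a and a row b, read off two
    triangular factorizations of the same block matrix. *)
Lemma det_refl d c : \det (refl d c) = 1 + c * '[d, d].
Proof.
set a := (map_mx (fun x : F => x ^+ q) d)^T.
have: \det (block_mx (refl d c) (c *: a) 0 1%:M
              *m block_mx 1%:M 0 (- d) (1%:M : 'M_1))
    = \det (block_mx 1%:M 0 (- d) 1%:M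
              *m block_mx (1%:M : 'M_n) (c *: a) 0 (1 + c * '[d, d])%:M).
  congr (\det _); rewrite !mulmx_block.
  rewrite !(mulmx1, mul1mx, mulmx0, mul0mx, addr0, add0r).
  rewrite mulmxN -scalemxAl addrK mulNmx -scalemxAr herm_mx.
  by congr block_mx; rewrite scale_scalar_mx raddfD /= addrC addrK.
by rewrite !det_mulmx !det_ublock !det_lblock !det1 !mulr1 !mul1r det_scalar1.
Qed.

(** The special unitary group of U, extended by the identity on perp U. *)
Definition SUon U : {set 'M[F]_n} :=
  [set M in SUmx F q n | perp U *m M == perp U].

Definition GUon U : {set 'M[F]_n} :=
  [set M in GUmx F q n | perp U *m M == perp U].

Lemma GUon_GU U M : M \in GUon U -> M \in GUmx F q n.
Proof. by rewrite inE => /andP[]. Qed.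

Lemma GUon_fix U M x : M \in GUon U -> (x <= perp U)%MS -> x *m M = x.
Proof.
by rewrite inE => /andP[_ /eqP fM] /submxP[z ->]; rewrite -mulmxA fM.
Qed.

Lemma GUonP U M : M \in GUmx F q n ->
  (forall x, (x <= perp U)%MS -> x *m M = x) -> M \in GUon U.
Proof.
move=> uM fM; rewrite inE uM; apply/eqP/row_matrixP=> i.
by rewrite row_mul fM // row_sub.
Qed.

Lemma SUonE U M : (M \in SUon U) = (M \in GUon U) && (\det M == 1).
Proof. by rewrite !inE andbAC. Qed.

Lemma GUon_mul U M M' : M \in GUon U -> M' \in GUon U -> M *m M' \in GUon U.
Proof.
move=> uM uM'; apply: GUonP => [|x xU]; first by rewrite GUmx_mul ?(@GUon_GU U).
by rewrite mulmxA (GUon_fix uM) ?(GUon_fix uM').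
Qed.

Lemma perp_perp U x : nondeg U -> (x <= perp (perp U))%MS -> (x <= U)%MS.
Proof.
move=> ndU xPP; have [u [w [uU wP xE]]] := nondeg_decomp x ndU.
suff w0 : w = 0 by rewrite xE w0 addr0.
have ww v : (v <= perp U)%MS -> '[w, v] = 0.
  move=> vP; rewrite -(addKr u w) -xE addrC hermDl hermNl.
  by rewrite (perpP _ _ xPP) // (perpC vP) // subr0.
apply: herm_nondeg => v; have [v1 [v2 [v1U v2P ->]]] := nondeg_decomp v ndU.
by rewrite hermDr (ww v2) // (perpP _ _ wP) // addr0.
Qed.

Lemma GUon_stable U M x : nondeg U -> M \in GUon U -> (x <= U)%MS ->
  (x *m M <= U)%MS.
Proof.
move=> ndU uM xU; apply: (perp_perp ndU); apply/perpP=> y yP.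
by rewrite -{1}(GUon_fix uM yP) (GUmxP _ (GUon_GU uM)) (perpC yP).
Qed.

Lemma refl_fix d c x : '[x, d] = 0 -> x *m refl d c = x.
Proof. by rewrite mul_refl => ->; rewrite mulr0 scale0r addr0. Qed.

Lemma refl_GUon U d c : (d <= U)%MS -> c + c ^+ q + c * c ^+ q * '[d, d] = 0 ->
  refl d c \in GUon U.
Proof.
move=> dU cP; apply: GUonP => [|x xP]; first exact: refl_GU.
by rewrite refl_fix // (perpP _ _ xP).
Qed.

Lemma transvection_SUon U d l : (d <= U)%MS -> '[d, d] = 0 -> l ^+ q = - l ->
  refl d l \in SUon U.
Proof.
move=> dU d0 lq; rewrite SUonE det_refl d0 mulr0 addr0 eqxx andbT.
by apply: refl_GUon; rewrite // lq d0 mulr0 addr0 subrr.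
Qed.

(** With d = u' - u, equality of the norms of u and u' says that <d, d> is the
    opposite of the trace of <u, d>, which is the unitarity condition of refl_GU
    for the only scalar c such that refl d c moves u to u'. When d is isotropic
    the result is a transvection. *)
Lemma refl_move u u' : '[u, u] = '[u', u'] -> '[u, u' - u] != 0 ->
  let d := u' - u in let c := '[u, d]^-1 in
  c + c ^+ q + c * c ^+ q * '[d, d] = 0 /\ u *m refl d c = u'.
Proof.
move=> uu' d0 /=; set d := u' - u in d0 *; split; last first.
  by rewrite mul_refl mulVf // scale1r addrC subrK.
have dd : '[d, d] = - ('[u, d] + '[u, d] ^+ q).
  rewrite -hermC !hermE (hermC u u') -uu'; ring.
have d0q : '[u, d] ^+ q != 0 by rewrite conj_eq0.
by rewrite dd exprVn; field; rewrite d0q.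
Qed.

(** * Witt's theorem for vectors *)

(** The norm of y + t u is the norm of y plus the trace of t <u, y>, and the
    trace is onto the fixed field. *)
Lemma isotropic_adjust u y : '[u, u] = 0 -> '[u, y] != 0 ->
  exists t, '[y + t *: u, y + t *: u] = 0.
Proof.
move=> uu uy; have [|z zE] := @trace_onto (- '[y, y]).
  by rewrite conjN -hermC.
exists (z / '[u, y]); rewrite !hermE uu (hermC u y) exprMn exprVn.
have uyq : '[u, y] ^+ q != 0 by rewrite conj_eq0.
have -> : '[y, y] = - (z + z ^+ q) by rewrite zE opprK.
by field; rewrite uyq.
Qed.

Lemma nondeg_ex2 U x1 x2 : nondeg U -> (x1 <= U)%MS -> (x2 <= U)%MS ->
  x1 != 0 -> x2 != 0 ->
  exists y, [/\ (y <= U)%MS, '[y, x1] != 0 & '[y, x2] != 0].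
Proof.
move=> ndU x1U x2U /(nondeg_ex ndU x1U)[y1 y1U y11].
move=> /(nondeg_ex ndU x2U)[y2 y2U y22].
have [y12|] := eqVneq '[y1, x2] 0; last by exists y1.
have [y21|] := eqVneq '[y2, x1] 0; last by exists y2.
by exists (y1 + y2); rewrite addmx_sub // !hermDl y12 y21 addr0 add0r.
Qed.

(** This provides quasi-reflections of arbitrary determinant of norm 1 in the
    stabilizer of x; in dimension 2 it fails if x is isotropic and nonzero. *)
Lemma perp_nonisotropic U x : nondeg U -> (2 < \rank U)%N -> (x <= U)%MS ->
  exists r, [/\ (r <= U)%MS, '[r, r] != 0 & '[r, x] = 0].
Proof.
move=> ndU rkU xU.
have [xx|x0] := eqVneq '[x, x] 0; last first.
  have [ndx rkx] := nondeg_cap ndU xU x0.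
  have [|r] := nondeg_nonisotropic ndx; first exact: leq_trans (ltnW rkU) rkx.
  by rewrite sub_capmx => /andP[rU /perp_rVP rx] r0; exists r.
have [|r rU r0] := nondeg_nonisotropic ndU; first exact: leq_trans rkU.
have [rx|rx] := eqVneq '[r, x] 0; first by exists r.
have [ndr rkr] := nondeg_cap ndU rU r0.
(* Since x is isotropic and not orthogonal to r, its projection y to the
   complement of r in U is not isotropic. *)
pose y := x - ('[x, r] / '[r, r]) *: r.
have yr : '[y, r] = 0 by rewrite !hermE divfK // subrr.
have yU : (y <= U :&: perp r)%MS.
  rewrite sub_capmx addmx_sub ?eqmx_opp ?scalemx_sub //=; exact/perp_rVP.
have y0 : '[y, y] != 0.
  rewrite [in X in herm q _ X]/y hermDr hermNr hermZr yr mulr0 subr0.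
  rewrite hermDl xx hermNl hermZl add0r oppr_eq0 !mulf_neq0 ?invr_eq0 //.
  by rewrite herm_eq0C.
have [ndy rky] := nondeg_cap ndr yU y0.
have [|s] := nondeg_nonisotropic ndy.
  by rewrite -ltnS (leq_trans _ rky) // -ltnS (leq_trans rkU).
rewrite sub_capmx => /andP[]; rewrite sub_capmx => /andP[sU /perp_rVP sr].
move=> /perp_rVP sy s0; exists s; split=> //.
by move: sy; rewrite !hermE sr mulr0 oppr0 addr0.
Qed.

Lemma nondeg_norm_onto U m : nondeg U -> (1 < \rank U)%N -> m ^+ q = m ->
  exists r, [/\ (r <= U)%MS, r != 0 & '[r, r] = m].
Proof.
move=> ndU rkU mq.
have [|x xU x0] := nondeg_nonisotropic ndU; first exact: ltnW.
have nz r : '[r, r] != 0 -> r != 0 by apply: contraNneq => ->; rewrite herm0l.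
have [m0|m0] := eqVneq m 0; last first.
  have [|t tE] := @norm_onto (m / '[x, x]).
    by rewrite exprMn exprVn mq norm_conj.
  have tm : '[t *: x, t *: x] = m by rewrite !hermE mulrA tE divfK.
  by exists (t *: x); rewrite scalemx_sub // nz ?tm.
have [ndx rkx] := nondeg_cap ndU xU x0.
have [|y] := nondeg_nonisotropic ndx; first by rewrite -ltnS (leq_trans _ rkx).
rewrite sub_capmx => /andP[yU /perp_rVP yx] y0.
have [|t tE] := @norm_onto (- '[x, x] / '[y, y]).
  by rewrite exprMn exprVn conjN !norm_conj.
have xy : '[x, y] = 0 by rewrite hermC yx conj0.
exists (x + t *: y); rewrite addmx_sub ?scalemx_sub //; split=> //.
  apply: contraNneq x0 => /(congr1 (fun v => '[x, v])).
  by rewrite !hermE xy herm0r mulr0 addr0 => ->.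
by rewrite !hermE xy yx !(mulr0, add0r, addr0) mulrA tE divfK // subrr m0.
Qed.

(** One quasi-reflection is enough unless <u, u'> = <u, u>; then two are,
    through a vector z: a multiple of u if u is not isotropic, and otherwise an
    isotropic vector orthogonal to neither u nor u'. *)
Lemma GUon_trans U u u' : nondeg U -> (u <= U)%MS -> (u' <= U)%MS ->
  u != 0 -> u' != 0 -> '[u, u] = '[u', u'] ->
  exists2 M, M \in GUon U & u *m M = u'.
Proof.
move=> ndU.
have step x y : (x <= U)%MS -> (y <= U)%MS -> '[x, x] = '[y, y] ->
    '[x, y] != '[x, x] -> exists2 M, M \in GUon U & x *m M = y.
  move=> xU yU xy d0; have [|cP xM] := refl_move xy.
    by rewrite hermDr hermNr subr_eq0.
  exists (refl (y - x) '[x, y - x]^-1); last by [].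
  by rewrite refl_GUon ?addmx_sub ?eqmx_opp.
move=> uU u'U u0 u'0 uu'.
have [d0|] := eqVneq '[u, u'] '[u, u]; last exact: step.
suff [z [zU zz uz zu']] : exists z,
    [/\ (z <= U)%MS, '[z, z] = '[u, u], '[u, z] != '[u, u]
      & '[z, u'] != '[u, u]].
  have [M1 uM1 uz1] := step _ _ uU zU (esym zz) uz.
  have [||M2 uM2 zu2] := step z u' zU u'U; rewrite ?zz //.
  by exists (M1 *m M2); rewrite ?GUon_mul // mulmxA uz1.
have [c0|c0] := eqVneq '[u, u] 0.
  have [y [yU yu yu']] := nondeg_ex2 ndU uU u'U u0 u'0.
  have [|t tE] := isotropic_adjust c0 (_ : '[u, y] != 0).
    by rewrite herm_eq0C.
  exists (y + t *: u); rewrite c0 addmx_sub ?scalemx_sub //; split=> //.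
    by rewrite hermDr hermZr c0 mulr0 addr0 herm_eq0C.
  by rewrite hermDl hermZl d0 c0 mulr0 addr0.
have [z z1 zz] := exists_norm1.
have cz c : c != 0 -> z * c != c.
  move=> nzc; rewrite -subr_eq0 -[X in _ - X]mul1r -mulrBl.
  by rewrite mulf_neq0 // subr_eq0.
exists (z *: u); rewrite scalemx_sub //; split=> //.
- by rewrite hermZl hermZr mulrA zz mul1r.
- apply/eqP=> /(congr1 (fun a : F => a ^+ q)).
  rewrite hermZr exprMn conjK norm_conj.
  exact/eqP/cz.
- by rewrite hermZl d0 cz.
Qed.

(** The determinant of the isometry given by GUon_trans is corrected by a
    quasi-reflection along a vector orthogonal to u'. *)
Lemma SUon_trans U u u' : nondeg U -> (2 < \rank U)%N ->
  (u <= U)%MS -> (u' <= U)%MS -> u != 0 -> u' != 0 -> '[u, u] = '[u', u'] ->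
  exists2 M, M \in SUon U & u *m M = u'.
Proof.
move=> ndU rkU uU u'U u0 u'0 uu'.
have [M uM uMu'] := GUon_trans ndU uU u'U u0 u'0 uu'.
have [r [rU r0 ru']] := perp_nonisotropic ndU rkU u'U.
have dM := GUmx_det (GUon_GU uM).
have d0 : \det M != 0.
  by apply/eqP=> d0; move/eqP: dM; rewrite d0 mul0r eq_sym oner_eq0.
have dq0 : \det M ^+ q != 0 by rewrite conj_eq0.
pose c := ((\det M)^-1 - 1) / '[r, r].
have uR : refl r c \in GUon U.
  apply: refl_GUon => //.
  rewrite /c exprMn conjD conjN expr1n !exprVn norm_conj.
  transitivity (((\det M * \det M ^+ q)^-1 - 1) / '[r, r]).
    by field; rewrite r0 dq0 d0.
  by rewrite dM invr1 subrr mul0r.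
exists (M *m refl r c).
  rewrite SUonE GUon_mul //= det_mulmx det_refl divfK //.
  by rewrite [1 + _]addrC subrK divff.
by rewrite mulmxA uMu' refl_fix // hermC ru' conj0.
Qed.

Lemma SUon_GUon U M : M \in SUon U -> M \in GUon U.
Proof. by rewrite SUonE => /andP[]. Qed.

Lemma SUon_mul U M M' : M \in SUon U -> M' \in SUon U -> M *m M' \in SUon U.
Proof.
rewrite !SUonE => /andP[uM /eqP dM] /andP[uM' /eqP dM'].
by rewrite GUon_mul // det_mulmx dM dM' mulr1 /=.
Qed.

Lemma SUon_sub U W : (U <= W)%MS -> SUon U \subset SUon W.
Proof.
move=> sUW; apply/subsetP=> M; rewrite !SUonE => /andP[uM ->]; rewrite andbT.
apply: GUonP => [|x /perpP xW]; first exact: GUon_GU uM.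
by apply: GUon_fix uM _; apply/perpP=> y yU; rewrite xW // (submx_trans yU).
Qed.

Lemma eq_mx_act M M' : (forall x, x *m M = x *m M') -> M = M'.
Proof. by move=> eM; apply/row_matrixP=> i; rewrite !rowE. Qed.

Lemma refl_scale a d c : refl (a *: d) c = refl d (a * a ^+ q * c).
Proof.
apply: eq_mx_act => x; rewrite !mul_refl hermZr scalerA.
by congr (_ + _ *: _); ring.
Qed.

Lemma refl_conj d c M : M \in GUmx F q n ->
  refl (d *m M) c = invmx M *m refl d c *m M.
Proof.
move=> uM; have iM := GUmx_unit uM; apply: eq_mx_act => x.
rewrite !mulmxA !mul_refl mulmxDl mulmxKV // -scalemxAl.
by rewrite -(GUmxP _ (GUmx_inv uM)) mulmxK.
Qed.

(** * Transvections in an irreducible group of isometries *)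

Section Transvections.

Variable G : {set 'M[F]_n}.
Hypothesis GM : forall M M', M \in G -> M' \in G -> M *m M' \in G.
Hypothesis GV : forall M, M \in G -> invmx M \in G.
Hypothesis GU : forall M, M \in G -> M \in GUmx F q n.
Hypothesis G_irr : forall U,
  U != 0 -> (forall M, M \in G -> (U *m M <= U)%MS) -> row_full U.

(** The isotropic vectors, 0 included, along which every transvection belongs
    to G. *)
Definition root_vector : pred 'rV[F]_n := [pred x |
  ('[x, x] == 0) && [forall l : F, (l ^+ q == - l) ==> (refl x l \in G)]].

Notation X := root_vector.

Lemma root_vectorP x : reflect
  ('[x, x] = 0 /\ forall l, l ^+ q = - l -> refl x l \in G) (X x).
Proof.
apply: (iffP andP) => -[xx xG]; split.
- exact/eqP.
- by move=> l lq; have /implyP := forallP xG l; apply; apply/eqP.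
- exact/eqP.
by apply/forallP=> l; apply/implyP=> /eqP; apply: xG.
Qed.

Lemma root_scale a x : X x -> X (a *: x).
Proof.
move=> /root_vectorP[xx xG]; apply/root_vectorP.
rewrite hermZl hermZr xx !mulr0; split=> // l lq.
by rewrite refl_scale xG // !exprMn conjK lq; ring.
Qed.

Lemma root_orbit x M : X x -> M \in G -> X (x *m M).
Proof.
move=> /root_vectorP[xx xG] gM; apply/root_vectorP.
rewrite (GUmxP _ (GU gM)); split=> // l lq.
by rewrite (refl_conj _ _ (GU gM)) !GM ?GV ?xG.
Qed.

Lemma herm_line x y c : '[x, x] = 0 -> '[y, y] = 0 ->
  '[x + c *: y, x + c *: y] = c * '[y, x] + (c * '[y, x]) ^+ q.
Proof.
move=> xx yy; rewrite !hermE xx yy (hermC y x) exprMn.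
by rewrite !(mulr0, addr0, add0r) addrC.
Qed.

(** The transvections along v permute transitively the other isotropic points
    of any hyperbolic line through v. *)
Lemma root_line v w c : X v -> X w -> '[w, v] != 0 ->
  '[w + c *: v, w + c *: v] = 0 -> X (w + c *: v).
Proof.
move=> /root_vectorP[vv vG] Xw wv0; have /root_vectorP[ww _] := Xw.
rewrite !hermE vv ww (hermC w v) !(mulr0, add0r, addr0) => cE.
have -> : w + c *: v = w *m refl v (c / '[w, v]) by rewrite mul_refl divfK.
apply: root_orbit => //; apply: vG; rewrite exprMn exprVn.
have wvq : '[w, v] ^+ q != 0 by rewrite conj_eq0.
apply: (mulIf wvq); apply: (mulIf wv0); rewrite divfK // mulNr.
move/eqP: cE; rewrite addr_eq0 => /eqP->.
by rewrite -mulNr; field.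
Qed.

Lemma root_SUon U x : SUon U \subset G -> (x <= U)%MS -> '[x, x] = 0 -> X x.
Proof.
move=> /subsetP sG xU xx; apply/root_vectorP; split=> // l lq.
by apply: sG; apply: transvection_SUon.
Qed.

(** The root vectors span a nonzero invariant subspace. *)
Lemma root_not_orthogonal x w : X x -> x != 0 -> w != 0 ->
  exists2 y, X y & '[y, w] != 0.
Proof.
move=> Xx x0 w0.
have /existsP[y /andP[]] : [exists y, X y && ('[y, w] != 0)]; last by exists y.
apply: contraNT w0; rewrite negb_exists => /forallP all0.
pose A := (\sum_(y | X y) <<y>>)%MS.
have yA y : X y -> (y <= A)%MS.
  by move=> Xy; apply: (sumsmx_sup y); rewrite ?genmxE.
have fullA : row_full A.
  apply: G_irr => [|M gM].
    by apply: contraNneq x0 => A0; rewrite -submx0 -A0 yA.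
  rewrite {1}/A sumsmxMr.
  apply/sumsmx_subP=> y Xy; rewrite (eqmxMr _ (genmxE _)); exact/yA/root_orbit.
suff wP : (A <= perp w)%MS.
  apply/eqP/herm_nondeg=> v.
  rewrite hermC; apply/eqP; rewrite conj_eq0; apply/eqP.
  exact/perp_rVP/(submx_trans (submx_full _ fullA)).
apply/sumsmx_subP=> y Xy; rewrite genmxE; apply/perp_rVP.
by have := all0 y; rewrite Xy negbK => /eqP.
Qed.

(** * Enlarging a nondegenerate subspace *)

Section Enlarge.

Variable U : 'M[F]_n.
Hypotheses (ndU : nondeg U) (rkU : (2 < \rank U)%N) (sUG : SUon U \subset G).

(** SUon U moves u to u' and fixes w. *)
Lemma root_translate u w u' : (u <= U)%MS -> (w <= perp U)%MS ->
  (u' <= U)%MS -> u != 0 -> u' != 0 -> '[u, u] = '[u', u'] ->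
  X (u + w) -> X (u' + w).
Proof.
move=> uU wP u'U u0 u'0 uu' Xuw.
have [M uM <-] := SUon_trans ndU rkU uU u'U u0 u'0 uu'.
have -> : u *m M + w = (u + w) *m M.
  by rewrite mulmxDl (GUon_fix (SUon_GUon uM) wP).
exact/root_orbit/(subsetP sUG).
Qed.

Lemma herm_decomp u w u' w' : (u <= U)%MS -> (w <= perp U)%MS ->
  (u' <= U)%MS -> (w' <= perp U)%MS ->
  '[u + w, u' + w'] = '[u, u'] + '[w, w'].
Proof.
move=> uU wP u'U w'P.
by rewrite !hermE (perpC w'P) // (perpP _ _ wP u') // addr0 add0r.
Qed.

(** If w is isotropic, root_translate puts u' + w among the root vectors for
    all isotropic u' in U. Irreducibility provides a root vector u1 + w1 with
    w1 not orthogonal to w; on the hyperbolic line through u' + w and u1 + w1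
    the component in perp U is isotropic everywhere only if <u1, u'> / <w1, w>
    is fixed by conjugation, which the choice of u' avoids. If u1 = 0 there is
    no such choice, and u1 + w1 is first replaced by another point of its line
    through u + w. *)
Lemma root_nonisotropic_part x : X x -> ~~ (x <= U)%MS -> ~~ (x <= perp U)%MS ->
  exists u w, [/\ (u <= U)%MS, (w <= perp U)%MS, '[w, w] != 0 & X (u + w)].
Proof.
move=> Xx xU xP; have [u [w [uU wP xE]]] := nondeg_decomp x ndU.
have u0 : u != 0 by apply: contraNneq xP => u0; rewrite xE u0 add0r.
have w0 : w != 0 by apply: contraNneq xU => w0; rewrite xE w0 addr0.
have [ww|] := eqVneq '[w, w] 0; last by exists u, w; rewrite -xE.
have uw0 u1 w1 : (u1 <= U)%MS -> (w1 <= perp U)%MS -> '[w1, w1] = 0 ->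
    X (u1 + w1) -> '[u1, u1] = 0.
  by move=> u1U w1P w1w1 /root_vectorP[<- _]; rewrite herm_decomp // w1w1 addr0.
have uu : '[u, u] = 0 by apply: uw0 uU wP ww _; rewrite -xE.
have Xw u' : (u' <= U)%MS -> u' != 0 -> '[u', u'] = 0 -> X (u' + w).
  move=> u'U u'0 u'u'; apply: (root_translate uU wP) => //; last by rewrite -xE.
  by rewrite uu u'u'.
have key u1 w1 : (u1 <= U)%MS -> (w1 <= perp U)%MS -> u1 != 0 ->
    X (u1 + w1) -> '[w1, w] != 0 ->
    exists u w, [/\ (u <= U)%MS, (w <= perp U)%MS, '[w, w] != 0 & X (u + w)].
  move=> u1U w1P u10 X1 k0.
  have [w1w1|] := eqVneq '[w1, w1] 0; last by exists u1, w1.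
  have u1u1 := uw0 _ _ u1U w1P w1w1 X1.
  (* The scalar s is the value of <u1, u'> for which <w1, w> = z (s + <w1, w>);
     the norm of the component in perp U is then the trace of l z, which is
     nonzero because z is not fixed by conjugation. *)
  have [z zq] := exists_not_fixed.
  have z0 : z != 0 by apply: contraNneq zq => ->; rewrite conj0.
  have z1 : z != 1 by apply: contraNneq zq => ->; rewrite expr1n.
  set k := '[w1, w] in k0.
  pose s := k / z - k.
  have s0 : s != 0.
    rewrite subr_eq0; apply: contraNneq z1 => kE.
    by apply/eqP/(mulfI k0); rewrite mulr1 -{1}kE divfK.
  have [y yU yu1] := nondeg_ex ndU u1U u10.
  pose y1 := (s / '[u1, y]) ^+ q *: y.
  have y1u1 : '[u1, y1] = s by rewrite hermZr conjK divfK // herm_eq0C.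
  have [|t tE] := isotropic_adjust u1u1 (_ : '[u1, y1] != 0).
    by rewrite y1u1.
  set u' := y1 + t *: u1 in tE.
  have u'U : (u' <= U)%MS by rewrite addmx_sub ?scalemx_sub.
  have u1u' : '[u1, u'] = s by rewrite hermDr hermZr y1u1 u1u1 mulr0 addr0.
  have u'0 : u' != 0 by apply: contraNneq s0 => E; rewrite -u1u' E herm0r.
  have eE : '[u1 + w1, u' + w] = k / z.
    by rewrite herm_decomp // u1u' -/k /s subrK.
  have [l l0 lq] := exists_skew.
  pose c := l / (k / z).
  have cE : c * '[u1 + w1, u' + w] = l.
    by rewrite eE divfK // mulf_neq0 ?invr_eq0.
  exists (u' + c *: u1), (w + c *: w1).
  have X' := Xw _ u'U u'0 tE.
  split; rewrite ?addmx_sub ?scalemx_sub //.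
    have ck : c * '[w1, w] = l * z by rewrite -/k /c; field; rewrite z0.
    rewrite herm_line // ck exprMn lq mulNr subr_eq0.
    by rewrite (inj_eq (mulfI l0)) eq_sym.
  have -> : u' + c *: u1 + (w + c *: w1) = (u' + w) + c *: (u1 + w1).
    by rewrite scalerDr addrACA.
  apply: root_line => //.
    by rewrite herm_eq0C eE mulf_neq0 ?invr_eq0.
  have /root_vectorP[X10 _] := X1; have /root_vectorP[X'0 _] := X'.
  by rewrite herm_line // cE lq subrr.
have x0 : x != 0 by apply: contraNneq xU => ->; rewrite sub0mx.
have [y Xy yw] := root_not_orthogonal Xx x0 w0.
have [u1 [w1 [u1U w1P yE]]] := nondeg_decomp y ndU.
have w1w : '[w1, w] != 0 by move: yw; rewrite yE hermDl (perpC wP) // add0r.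
have [u10|u10] := eqVneq u1 0; last by apply: (key u1 w1); rewrite -?yE.
have Xw1 : X w1 by rewrite -[w1]add0r -u10 -yE.
have [w1w1 _] := root_vectorP _ Xw1.
have [l l0 lq] := exists_skew.
have xw1 : '[w1, u + w] = '[w1, w] by rewrite hermDr (perpP _ _ w1P) // add0r.
apply: (key u (w + (l / '[w1, w]) *: w1)) => //.
- by rewrite addmx_sub ?scalemx_sub.
- rewrite addrA; apply: root_line; rewrite -?xE //.
    by rewrite herm_eq0C xE xw1.
  have /root_vectorP[xx _] := Xx.
  by rewrite herm_line // xE xw1 divfK // lq subrr.
by rewrite hermDl hermZl divfK // ww add0r.
Qed.

Section AddVector.

Variables u w : 'rV[F]_n.
Hypotheses (uU : (u <= U)%MS) (wP : (w <= perp U)%MS).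
Hypotheses (w0 : '[w, w] != 0) (Xuw : X (u + w)).

Local Notation W := (U + w)%MS.

Lemma addv_decomp z : (z <= W)%MS ->
  exists v b, (v <= U)%MS /\ z = v + b *: w.
Proof.
move=> /sub_addsmxP[[a b] /= ->]; exists (a *m U), (b 0 0).
by rewrite submxMl {1}[b]mx11_scalar mul_scalar_mx.
Qed.

Lemma addv_sub v b : (v <= U)%MS -> ((v + b *: w)%R <= W)%MS.
Proof. by move=> vU; rewrite addmx_sub_adds ?scalemx_sub. Qed.

Lemma herm_addv v b v' b' : (v <= U)%MS -> (v' <= U)%MS ->
  '[v + b *: w, v' + b' *: w] = '[v, v'] + b * b' ^+ q * '[w, w].
Proof.
by move=> vU v'U; rewrite herm_decomp ?scalemx_sub // hermZl hermZr mulrA.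
Qed.

Lemma root_add z : (z <= W)%MS -> '[z, z] = 0 -> X z.
Proof.
have /root_vectorP[uw0 _] := Xuw; rewrite herm_decomp // in uw0.
have uuE : '[u, u] = - '[w, w] by apply/eqP; rewrite -addr_eq0 uw0.
case/addv_decomp=> v [b [vU ->]] vb0.
have [b0|b0] := eqVneq b 0.
  by move: vb0; rewrite b0 scale0r addr0; exact: root_SUon sUG vU.
have -> : v + b *: w = b *: (b^-1 *: v + w).
  by rewrite scalerDr scalerA divff // scale1r.
have vv : '[b^-1 *: v, b^-1 *: v] = - '[w, w].
  have : '[b^-1 *: (v + b *: w), b^-1 *: (v + b *: w)] = 0.
    by rewrite hermZl hermZr vb0 !mulr0.
  rewrite scalerDr scalerA mulVf // scale1r herm_decomp ?scalemx_sub // => /eqP.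
  by rewrite addr_eq0 => /eqP.
have nz v1 : '[v1, v1] = - '[w, w] -> v1 != 0.
  by move=> E; apply: contraNneq w0 => v10; rewrite -oppr_eq0 -E v10 herm0l.
apply: root_scale; apply: (root_translate uU wP); rewrite ?scalemx_sub ?nz //.
by rewrite vv.
Qed.

(** A transvection moves z = u1 + b w to w as soon as z - w is isotropic, that
    is b has trace 2, and b != 1 (P1). Transvections along v = u0 + w change b
    by an amount that depends on <u1, u0>; if u1 != 0 the group SUon U can give
    <u1, u0> any value, hence b the value 1 + l with l of trace 0 (P2). If
    u1 = 0, one transvection along v makes the component in U nonzero. *)
Lemma norm_trans z : (z <= W)%MS -> '[z, z] = '[w, w] ->
  exists M, [/\ M \in G, M \in SUon W & z *m M = w].
Proof.
have [u0 [u0U u00 u0u0]] :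
    exists r, [/\ (r <= U)%MS, r != 0 & '[r, r] = - '[w, w]].
  by apply: nondeg_norm_onto; rewrite ?(ltnW rkU) // conjN norm_conj.
have u0n : '[u0, u0] != 0 by rewrite u0u0 oppr_eq0.
have [l l0 lq] := exists_skew.
pose v := u0 + w.
have vE : v = u0 + 1 *: w by rewrite scale1r.
have vW : (v <= W)%MS by rewrite vE addv_sub.
have vv : '[v, v] = 0 by rewrite herm_decomp // u0u0 addNr.
have tG d c : (d <= W)%MS -> '[d, d] = 0 -> c ^+ q = - c ->
    refl d c \in G /\ refl d c \in SUon W.
  move=> dW dd cq; split; last exact: transvection_SUon.
  by have /root_vectorP[_] := root_add dW dd; apply.
pose P z := exists M, [/\ M \in G, M \in SUon W & z *m M = w].
have Pmul z1 M : M \in G -> M \in SUon W -> P (z1 *m M) -> P z1.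
  move=> gM uM [M' [gM' uM' E]]; exists (M *m M').
  by rewrite GM ?SUon_mul ?mulmxA.
have tE u1 b : (u1 <= U)%MS ->
    (u1 + b *: w) *m refl v l
    = u1 + (l * ('[u1, u0] + b * '[w, w])) *: u0
      + (b + l * ('[u1, u0] + b * '[w, w])) *: w.
  move=> u1U; rewrite mul_refl {1}vE herm_addv // expr1n mulr1 /v.
  rewrite scalerDr scalerDl.
  by rewrite addrACA.
have P1 u1 b : (u1 <= U)%MS -> b + b ^+ q = 2%:R -> b != 1 ->
    '[u1 + b *: w, u1 + b *: w] = '[w, w] -> P (u1 + b *: w).
  move=> u1U bq b1 zz; set z1 := u1 + b *: w in zz *.
  have z1w : '[z1, w] = b * '[w, w].
    by rewrite hermDl hermZl (perpC wP) // add0r.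
  have [|] := refl_move zz.
    rewrite hermDr hermNr zz z1w -[X in _ - X]mul1r -mulrBl.
    by rewrite mulf_neq0 ?subr_eq0.
  have dd : '[w - z1, w - z1] = 0.
    rewrite norm_sub zz (hermC z1 w) z1w exprMn norm_conj.
    transitivity ((2%:R - (b + b ^+ q)) * '[w, w]); first ring.
    by rewrite bq subrr mul0r.
  rewrite dd mulr0 addr0 => /eqP; rewrite addrC addr_eq0 => /eqP cq z1M.
  have [|gM uM] := tG (w - z1) ('[z1, w - z1])^-1 _ dd cq.
    by rewrite addmx_sub ?eqmx_opp ?addv_sub ?addsmxSr.
  by exists (refl (w - z1) '[z1, w - z1]^-1).
have P2 u1 b : (u1 <= U)%MS -> u1 != 0 ->
    '[u1 + b *: w, u1 + b *: w] = '[w, w] -> P (u1 + b *: w).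
  move=> u1U u10 zz.
  (* The value of <u1, u0> for which tE turns b into 1 + l. *)
  pose t := (1 + l - b) / l - b * '[w, w].
  have [nd0 rk0] := nondeg_cap ndU u0U u0n.
  have [e eE] : exists e, e * '[u0, u0] = t.
    by exists (t / '[u0, u0]); rewrite divfK.
  have [||r [rU0 r0 rr]] :=
    @nondeg_norm_onto _ ('[u1, u1] - e * e ^+ q * '[u0, u0]) nd0.
  - by rewrite -ltnS (leq_trans rkU).
  - by rewrite conjD conjN !exprMn conjK !norm_conj [e ^+ q * e]mulrC.
  have [rU /perp_rVP ru0] : (r <= U)%MS /\ (r <= perp u0)%MS.
    by move: rU0; rewrite sub_capmx => /andP.
  pose u2 := e *: u0 + r.
  have u2U : (u2 <= U)%MS by rewrite addmx_sub ?scalemx_sub.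
  have u2t : '[u2, u0] = t by rewrite hermDl hermZl ru0 addr0.
  have u20 : u2 != 0.
    apply: contraNneq r0 => E; have e0 : e = 0.
      by apply/(mulIf u0n); rewrite eE -u2t E herm0l mul0r.
    by rewrite -E /u2 e0 scale0r add0r.
  have u2u2 : '[u1, u1] = '[u2, u2].
    rewrite !hermE ru0 (hermC r u0) ru0 conj0 rr !mulr0 addr0 add0r.
    by rewrite mulrA addrC subrK.
  have [M uM u1M] := SUon_trans ndU rkU u1U u2U u10 u20 u2u2.
  have E1 : (u1 + b *: w) *m M = u2 + b *: w.
    by rewrite mulmxDl u1M (GUon_fix (SUon_GUon uM)) ?scalemx_sub.
  apply: (Pmul _ M); first exact: (subsetP sUG).
    exact: (subsetP (SUon_sub (addsmxSl _ _))).
  have [gT uT] := tG v l vW vv lq; apply: (Pmul _ (refl v l)) => //.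
  move: zz; rewrite -(GUmxP _ (GU (subsetP sUG _ uM))) E1.
  rewrite -(GUmxP _ (GU gT)) tE // u2t.
  have -> : b + l * (t + b * '[w, w]) = 1 + l by rewrite /t; field.
  apply: P1.
  - by rewrite addmx_sub ?scalemx_sub.
  - by rewrite conjD expr1n lq; ring.
  by rewrite -subr_eq0 addrC addKr.
case/addv_decomp=> u1 [b [u1U ->]] zz.
have [u10|] := eqVneq u1 0; last by move=> u10; apply: P2.
have [gT uT] := tG v l vW vv lq; apply: (Pmul _ (refl v l)) => //.
move: zz; rewrite -(GUmxP _ (GU gT)) tE // u10 herm0l !add0r => zz.
apply: P2 => //; first exact: scalemx_sub.
rewrite scaler_eq0 negb_or u00 andbT !mulf_neq0 //.
apply: contraNneq w0 => b0; move: zz; rewrite b0 mul0r mulr0 addr0 !scale0r.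
by rewrite addr0 herm0l => ->.
Qed.

(** An element of SUon W that fixes w belongs to SUon U, and norm_trans reduces
    to this case. *)
Lemma SUon_add : SUon W \subset G.
Proof.
have [ndW _] := nondeg_add ndU wP w0.
have wW : (w <= W)%MS := addsmxSr U w.
apply/subsetP=> M uM; have gM := GUon_GU (SUon_GUon uM).
have [||M' [gM' uM' wM]] := @norm_trans (w *m M).
- exact: GUon_stable (SUon_GUon uM) wW.
- by rewrite (GUmxP _ gM).
rewrite -[M](mulmxK (GUmx_unit (GU gM'))); apply: GM (GV gM').
apply: (subsetP sUG); have := SUon_mul uM uM'.
rewrite !SUonE => /andP[gMM' ->]; rewrite andbT; apply: GUonP => [|y yP].
  exact: GUon_GU gMM'.
pose c := '[y, w] / '[w, w].
have yE : (y - c *: w <= perp W)%MS.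
  apply/perpP=> _ /addv_decomp[v [b [vU ->]]].
  rewrite hermDr hermZr !hermDl !hermNl !hermZl divfK // subrr mulr0 addr0.
  by rewrite (perpP _ _ yP) // (perpP _ _ wP) // mulr0 subrr.
rewrite -{1}(subrK (c *: w) y) mulmxDl (GUon_fix gMM' yE) -scalemxAl.
by rewrite mulmxA wM subrK.
Qed.

End AddVector.

End Enlarge.

(** * Orthogonal decompositions preserved by the group *)

Lemma enlarge U x : nondeg U -> (2 < \rank U)%N -> SUon U \subset G ->
  X x -> ~~ (x <= U)%MS -> ~~ (x <= perp U)%MS ->
  exists W, [/\ nondeg W, (\rank U < \rank W)%N & SUon W \subset G].
Proof.
move=> ndU rkU sUG Xx xU xP.
have [u [w [uU wP w0 Xuw]]] := root_nonisotropic_part ndU rkU sUG Xx xU xP.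
have [ndW rkW] := nondeg_add ndU wP w0.
by exists (U + w)%MS; rewrite (SUon_add ndU rkU sUG uU).
Qed.

(** If y in U is not orthogonal to u, some y + t u is isotropic; and such y
    span U. *)
Lemma isotropic_span U u m (A : 'M_(m, n)) :
  nondeg U -> (u <= U)%MS -> u != 0 -> '[u, u] = 0 -> (u <= A)%MS ->
  (forall z, (z <= U)%MS -> '[z, z] = 0 -> '[z, u] != 0 -> (z <= A)%MS) ->
  (U <= A)%MS.
Proof.
move=> ndU uU u0 uu uA zA.
have yA y : (y <= U)%MS -> '[y, u] != 0 -> (y <= A)%MS.
  move=> yU yu; have [|t tE] := isotropic_adjust uu (_ : '[u, y] != 0).
    by rewrite herm_eq0C.
  rewrite -[y](addrK (t *: u)) addmx_sub ?eqmx_opp ?scalemx_sub // zA //.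
    by rewrite addmx_sub ?scalemx_sub.
  by rewrite hermDl hermZl uu mulr0 addr0.
apply: subrV => y yU; have [yu|] := eqVneq '[y, u] 0; last exact: yA.
have [x xU xu] := nondeg_ex ndU uU u0.
rewrite -[y](addrK x) addmx_sub ?eqmx_opp ?yA ?addmx_sub //.
by rewrite hermDl yu add0r.
Qed.

(** The image under M of an isotropic vector of U is a root vector, hence lies
    in U or in perp U. If z is not orthogonal to u then z M and u M are not
    orthogonal, so they lie on the same side; these z span U. *)
Lemma image_dichotomy U M : nondeg U -> (1 < \rank U)%N -> SUon U \subset G ->
  (forall x, X x -> (x <= U)%MS || (x <= perp U)%MS) -> M \in G ->
  (U *m M <= U)%MS || (U *m M <= perp U)%MS.
Proof.
move=> ndU rkU sUG Xdich gM; have uM := GU gM; have iM := GUmx_unit uM.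
have [|u [uU u0 uu]] := nondeg_norm_onto ndU rkU (_ : 0 ^+ q = 0).
  exact: conj0.
have dich z : (z <= U)%MS -> '[z, z] = 0 ->
    (z *m M <= U)%MS || (z *m M <= perp U)%MS.
  by move=> zU zz; apply/Xdich/root_orbit/gM/(root_SUon sUG).
have pull m (A : 'M_(m, n)) x : (x *m M <= A)%MS -> (x <= A *m invmx M)%MS.
  by move=> xA; rewrite -(mulmxK iM x) submxMr.
have push m (A : 'M_(m, n)) : (U <= A *m invmx M)%MS -> (U *m M <= A)%MS.
  by move=> UA; rewrite -(mulmxKV iM A) submxMr.
have nonorth z : '[z, u] != 0 -> '[z *m M, u *m M] != 0 by rewrite (GUmxP _ uM).
have /orP[uMU|uMP] := dich u uU uu; apply/orP; [left|right];
    apply/push/(isotropic_span ndU uU u0 uu (pull _ _ _ _)) => //;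
    move=> z zU zz /nonorth zu;
    apply: pull; have /orP[zM|zM] := dich z zU zz => //.
  by rewrite (perpP _ _ zM) ?eqxx in zu.
by rewrite (perpC uMP) ?eqxx in zu.
Qed.

Lemma GUmx_rank U M : M \in G -> \rank (U *m M) = \rank U.
Proof. by move=> /GU/GUmx_unit iM; rewrite mxrankMfree ?row_free_unit. Qed.

Lemma stable_full U : (0 < \rank U)%N ->
  (forall M, M \in G -> (U *m M <= U)%MS) -> \rank U = n.
Proof. by rewrite lt0n mxrank_eq0 => U0 /(G_irr U0)/eqP. Qed.

Lemma root_dichotomy U : 
  (exists x, [/\ X x, ~~ (x <= U)%MS & ~~ (x <= perp U)%MS]) \/
  (forall x, X x -> (x <= U)%MS || (x <= perp U)%MS).
Proof.
have [/existsP[x /and3P[Xx xU xP]]|] :=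
  boolP [exists x : 'rV_n, [&& X x, ~~ (x <= U)%MS & ~~ (x <= perp U)%MS]].
  by left; exists x.
rewrite negb_exists => /forallP all0; right=> x Xx.
by have := all0 x; rewrite Xx -negb_or negbK.
Qed.

(** If no enlargement of U is possible, image_dichotomy and the dimension of
    perp U, smaller than that of U, make U invariant. *)
Lemma SU_large U : nondeg U -> (2 < \rank U)%N -> (n < 2 * \rank U)%N ->
  SUon U \subset G -> SUmx F q n \subset G.
Proof.
have [k] := ubnP (n - \rank U); elim: k U => // k IHk U ltk ndU rkU halfU sUG.
have rkP := nondeg_rank ndU.
have [U_n|U_n] := eqVneq (\rank U) n.
  apply/(subset_trans _ sUG)/subsetP=> M uM; rewrite inE uM.
  have /eqP : \rank (perp U) = 0%N by lia.
  by rewrite mxrank_eq0 => /eqP->; rewrite mul0mx eqxx.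
have [[x [Xx xU xP]]|Xdich] := root_dichotomy U.
  have [W [ndW rkW sWG]] := enlarge ndU rkU sUG Xx xU xP.
  have := rank_leq_col W; have := rank_leq_col U.
  by move=> ? ?; apply: (IHk W) => //; lia.
case/eqP: U_n; apply: stable_full => [|M gM]; first by lia.
have /orP[//|UP] := image_dichotomy ndU (ltnW rkU) sUG Xdich gM.
by have := mxrankS UP; rewrite GUmx_rank //; lia.
Qed.

(** After one enlargement SU_large applies. Otherwise each M in G sends U to U
    or perp U, by equality of dimensions, and therefore perp U to the other
    one. *)
Lemma SU_or_imprimitive U :
  nondeg U -> (2 < \rank U)%N -> n = (2 * \rank U)%N -> SUon U \subset G ->
  SUmx F q n \subset G \/
  forall M, M \in G ->
    ((U *m M == U)%MS && (perp U *m M == perp U)%MS) ||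
    ((U *m M == perp U)%MS && (perp U *m M == U)%MS).
Proof.
move=> ndU rkU halfU sUG; have rkP := nondeg_rank ndU.
have [[x [Xx xU xP]]|Xdich] := root_dichotomy U.
  have [W [ndW rkW sWG]] := enlarge ndU rkU sUG Xx xU xP.
  by left; apply: (SU_large ndW) => //; lia.
right=> M gM; have eqM (A B : 'M[F]_n) : (A *m M <= B)%MS ->
    \rank A = \rank B -> (A *m M == B)%MS.
  move=> sAB rAB; rewrite -(geq_leqif (mxrank_leqif_eq sAB)).
  by rewrite (GUmx_rank A gM) rAB.
have PM (A : 'M[F]_n) : (U *m M <= A)%MS -> (\rank A <= \rank U)%N ->
    (perp U *m M <= perp A)%MS.
  move=> UA rA; apply: subrV => _ /submxP[z ->]; rewrite mulmxA.
  have : (z *m perp U *m M <= perp (U *m M))%MS.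
    by rewrite GUmx_perp ?submxMl ?GU.
  move/perpP=> zP; apply/perpP=> y yA; apply: zP; apply: submx_trans yA _.
  by rewrite -(geq_leqif (mxrank_leqif_sup UA)) (GUmx_rank U gM).
have rP : \rank (perp U) = \rank U by lia.
have [UM|UM] := orP (image_dichotomy ndU (ltnW rkU) sUG Xdich gM).
  by apply/orP; left; rewrite !eqM // PM.
suff PU : (perp U *m M <= U)%MS by apply/orP; right; rewrite !eqM.
apply: submx_trans (PM _ UM _) _; first by rewrite rP.
by apply: subrV => x; apply: perp_perp.
Qed.

End Transvections.

End Form.

(** * Coordinate subspaces *)

Lemma mul_pidE n a (x : 'rV[F]_n) i :
  (x *m pid_mx a) 0 i = if (i < a)%N then x 0 i else 0.
Proof.
rewrite mxE (bigD1 i) //= big1 => [|j ji]; rewrite mxE.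
  by rewrite eqxx addr0; case: ifP => _; rewrite ?mulr1 ?mulr0.
by rewrite (inj_eq val_inj) (negPf ji) mulr0.
Qed.

Lemma copid_perp n a : (copid_mx a <= perp (pid_mx a : 'M[F]_n))%MS.
Proof.
apply: subrV => _ /submxP[x ->]; apply/perpP=> _ /submxP[z ->].
apply: big1 => i _; rewrite mul_pidE mulmxBr mulmx1 [(x - _) 0 i]mxE.
rewrite [(- (x *m _)) 0 i]mxE mul_pidE.
by case: ifP => _; rewrite ?subrr ?mul0r ?conj0 ?mulr0.
Qed.

Lemma pid_copid n a (x : 'rV[F]_n) : x = x *m pid_mx a + x *m copid_mx a.
Proof. by rewrite mulmxBr mulmx1 addrC subrK. Qed.

Lemma nondeg_pid n a : nondeg (pid_mx a : 'M[F]_n).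
Proof.
apply/nondegP=> x; exists (x *m pid_mx a); first exact: submxMl.
rewrite {1}[x](pid_copid a) addrC addKr.
by rewrite (submx_trans (submxMl _ _)) ?copid_perp.
Qed.

Lemma perp_pid n a : (perp (pid_mx a : 'M[F]_n) :=: copid_mx a)%MS.
Proof.
apply/eqmxP; rewrite copid_perp andbT; apply: subrV => x xP.
rewrite [x](pid_copid a).
suff -> : x *m (pid_mx a : 'M_n) = 0 by rewrite add0r submxMl.
apply: (nondeg_eq0 (nondeg_pid n a)); first exact: submxMl.
rewrite -[_ *m (pid_mx a : 'M_n)](addrK (x *m copid_mx a)) -pid_copid.
rewrite addmx_sub ?eqmx_opp //.
by rewrite (submx_trans (submxMl _ _)) ?copid_perp.
Qed.

Lemma herm_row0 a k (u v : 'rV[F]_a) :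
  '[row_mx u (0 : 'rV_k), row_mx v 0] = '[u, v].
Proof.
rewrite /herm big_split_ord /= [X in _ + X]big1 ?addr0 => [|i _].
  by apply: eq_bigr => i _; rewrite !row_mxEl.
by rewrite row_mxEr mxE mul0r.
Qed.

Lemma block_embed_add a k (A : 'M[F]_a) :
  block_embed (a + k) A = block_mx A 0 0 1%:M.
Proof.
rewrite /block_embed; move: (a + k - a)%N (addKn a k) => k' ->.
exact: conform_mx_id.
Qed.

(** An isometry that is the identity on perp U stabilizes U; for a coordinate
    subspace U its matrix is therefore block diagonal. *)
Lemma SUon_pid n a : (a <= n)%N ->
  SUon (pid_mx a : 'M[F]_n) \subset [set block_embed n A | A in SUmx F q a].
Proof.
move=> le_an; have [k nE] : exists k, n = (a + k)%N.
  by exists (n - a)%N; rewrite subnKC.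
subst n; apply/subsetP=> M uM; apply/imsetP.
have gM := SUon_GUon uM; have ndU := nondeg_pid (a + k) a.
have pidE : pid_mx a = block_mx 1%:M 0 0 0 :> 'M[F]_(a + k).
  by rewrite pid_mx_block.
have copidE : copid_mx a = block_mx 0 0 0 1%:M :> 'M[F]_(a + k).
  rewrite /copid_mx pidE scalar_mx_block opp_block_mx add_block_mx.
  by rewrite !oppr0 !addr0 subrr.
have M1 : copid_mx a *m M = copid_mx a.
  apply/row_matrixP=> i; rewrite row_mul (GUon_fix gM) //.
  by rewrite (submx_trans (row_sub _ _)) ?copid_perp.
have M2 : (pid_mx a : 'M_(a + k)) *m M *m copid_mx a = 0.
  apply/row_matrixP=> i; rewrite row_mul row0.
  have /submxP[z ->] : (row i (pid_mx a *m M) <= (pid_mx a : 'M[F]_(a + k)))%MS.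
    by rewrite row_mul (GUon_stable ndU gM) // row_sub.
  by rewrite -mulmxA mul_pid_mx_copid ?mulmx0 // leq_addr.
have ME : M = block_mx (ulsubmx M) 0 0 1%:M.
  move: M1 M2; rewrite -[M]submxK block_mxKul copidE pidE !mulmx_block.
  rewrite !(mulmx0, mul0mx, mulmx1, mul1mx, addr0, add0r).
  rewrite -(block_mx0 _ a k a k).
  by move=> /eq_block_mx[_ _ -> ->] /eq_block_mx[_ -> _ _].
move: ME; set A := ulsubmx M; clearbody A => ME.
exists A; last by rewrite block_embed_add.
have dM : \det M = 1 by move: uM; rewrite SUonE => /andP[_ /eqP].
rewrite inE; apply/andP; split; last by rewrite -dM ME det_ublock det1 mulr1.
apply/GUmxP=> u v; rewrite -(herm_row0 k (u *m A)) -(herm_row0 k u).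
rewrite -[RHS](GUmxP _ (GUon_GU gM)) ME.
by rewrite !mul_row_block !mul0mx !mulmx0 !addr0.
Qed.

End UnitaryGeometry.

Theorem theorem1p4 (p q : nat) (p_prime : prime p)
    (q_pow : exists k : nat, q = (p ^ k)%N)
    (F : finFieldType) (cardF : #|F| = (q ^ 2)%N)
    (N : nat) (N_ge5 : (5 <= N)%N) (q_gt3 : (3 < q)%N)
    (Gamma : {group {'GL_N[F]}}) (Gamma_sub : Gamma \subset GU F q N)
    (Gamma_irr : mx_absolutely_irreducible (GL_repr Gamma))
    (a : nat) (a_le_N : (a <= N)%N) (a_ge_half : (N <= 2 * a)%N)
    (SUa_sub : SU_in F q N a \subset Gamma) :
  (N <> (2 * a)%N -> SU F q N \subset Gamma) /\
  (N = (2 * a)%N ->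
     SU F q N \subset Gamma \/
     exists2 g : {'GL_N[F]}, g \in GU F q N &
       (Gamma :^ g)%g \subset GU_wr2 F q N).
Proof.
have NE : N.-1.+1 = N by rewrite prednK //; lia.
have a_ge3 : (2 < a)%N by lia.
pose G : {set 'M[F]_N.-1.+1} := [set GLval g | g in Gamma].
have memG (g : {'GL_N[F]}) : (GLval g \in G) = (g \in Gamma).
  by rewrite mem_imset //; apply: val_inj.
have GM M M' : M \in G -> M' \in G -> M *m M' \in G.
  by move=> /imsetP[g gG ->] /imsetP[h hG ->]; rewrite -GL_MxE memG groupM.
have GV M : M \in G -> invmx M \in G.
  by move=> /imsetP[g gG ->]; rewrite -GL_VxE memG groupV.
have GU M : M \in G -> M \in GUmx F q N.-1.+1.
  by move=> /imsetP[g /(subsetP Gamma_sub) + ->]; rewrite inE.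
have G_irr (U : 'M[F]_N.-1.+1) : U != 0 ->
    (forall M, M \in G -> (U *m M <= U)%MS) -> row_full U.
  have [_ irr] := (mx_irrP _).1 (mx_abs_irrW Gamma_irr).
  move=> U0 UG; apply: irr => //.
  by apply/mxmoduleP=> g gG; apply: UG; rewrite memG.
have GLdet1 M : \det M = 1 -> exists g : {'GL_N[F]}, GLval g = M.
  move=> dM; have uM : M \is a GRing.unit.
    by rewrite [_ \is a _]unitmxE dM unitr1.
  by exists (FinRing.Unit uM).
pose U := pid_mx a : 'M[F]_N.-1.+1.
have rkU : \rank U = a by rewrite rank_pid_mx ?NE.
have ndU : nondeg q U := nondeg_pid p_prime q_pow cardF _ _.
have sUG : SUon q U \subset G.
  apply/subsetP=> M uM; have := uM; rewrite SUonE => /andP[_ /eqP/GLdet1[g gE]].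
  rewrite -gE memG; apply: (subsetP SUa_sub); rewrite inE gE.
  by apply: (subsetP (SUon_pid p_prime q_pow cardF _)); rewrite ?NE.
have SUsub : SUmx F q N.-1.+1 \subset G -> SU F q N \subset Gamma.
  by move=> sG; apply/subsetP=> g; rewrite inE => /(subsetP sG); rewrite memG.
have a_gt2 : (2 < \rank U)%N by rewrite rkU.
split=> [N2a | N2a].
  apply: SUsub; apply: (SU_large p_prime q_pow cardF GM GV GU G_irr ndU) => //.
  by rewrite rkU NE; lia.
have [|sSU|imp] :=
  SU_or_imprimitive p_prime q_pow cardF GM GV GU G_irr ndU a_gt2 _ sUG.
- by rewrite rkU NE.
- by left; apply: SUsub.
right; exists 1%g.
  by rewrite inE GUmx1.
rewrite conjsg1; apply/subsetP=> g gG; rewrite inE (subsetP Gamma_sub) //=.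
have -> : N./2 = a by rewrite N2a mul2n doubleK.
have := imp _ (etrans (memG g) gG).
have eqP : (perp q U :=: copid_mx a)%MS := perp_pid p_prime q_pow cardF _ _.
by rewrite !(eqmxMr _ eqP) !eqP.
Qed.
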